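(* For every pair of integers $1 \le k < N$ there exist a finite Borel measure $\mu$ in $\mathbb{R}^N$ with a compact support $X$ and an open set $\mathcal{U} \subset \mathrm{Lip}(X,\mathbb{R}^k)$, containing all full-rank linear maps $L \in \mathrm{Lin}(\mathbb{R}^N,\mathbb{R}^k)$ restricted to $X$, such that $\dim_H\mu = 0$ and no map $\phi \in \mathcal{U}$ is injective on a full $\mu$-measure set with continuous inverse (i.e. there is no $\phi\in\mathcal{U}$ and no full $\mu$-measure set $X_\phi\subset X$ such that $\phi|_{X_\phi}$ is injective and $(\phi|_{X_\phi})^{-1}\colon\phi(X_\phi)\to X_\phi$ is continuous).
   Context: $\mathrm{Lip}(X,\mathbb{R}^k)$ is the space of all Lipschitz functions $h\colon X\to\mathbb{R}^k$ on the compact set $X$, endowed with the norm $\|h\|_{\mathrm{Lip}} = \|h\|_\infty + \mathrm{Lip}(h)$, where $\|h\|_\infty$ is the supremum norm and $\mathrm{Lip}(h)$ is the Lipschitz constant of $h$. $\mathrm{Lin}(\mathbb{R}^N,\mathbb{R}^k)$ is the space of linear maps from $\mathbb{R}^N$ to $\mathbb{R}^k$. The Hausdorff dimension of $\mu$ is $\dim_H\mu = \inf\{\dim_H Y : Y\subset\mathbb{R}^N \text{ Borel with } \mu(\mathbb{R}^N\setminus Y)=0\}$. *)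

(* Defs.v *)
From mathcomp Require Import all_boot all_order all_algebra.
From mathcomp Require Import all_classical all_reals all_analysis.
Import Order.TTheory GRing.Theory Num.Theory.
Import numFieldNormedType.Exports.

Set Implicit Arguments.
Unset Strict Implicit.
Unset Printing Implicit Defensive.

Local Open Scope classical_set_scope.
Local Open Scope ring_scope.

(* The library norm on ['rV[R]_n] is the maximum norm. It induces the topology
   used below (open, compact, continuous, Borel), whereas all metric quantities
   (diameters, Lipschitz constants, supremum norms) use the Euclidean norm. *)
Definition enorm (R : realType) (n : nat) (x : 'rV[R]_n) : R :=
  Num.sqrt (\sum_(i < n) x ord0 i ^+ 2).

Definition borelRn (R : realType) (n : nat) :=
  g_sigma_algebraType (@open 'rV[R]_n).

Section measures.
Context {R : realType} {n : nat}.

Definition measure_support (mu : {measure set (borelRn R n) -> \bar R}) :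
    set 'rV[R]_n :=
  [set x | forall V : set 'rV[R]_n, open V -> V x -> (0 < mu V)%E].

(* [A] need not be Borel: its complement is contained in a Borel null set. *)
Definition full_measure (mu : {measure set (borelRn R n) -> \bar R})
    (A : set 'rV[R]_n) : Prop :=
  mu.-negligible (~` A).

(* Equal to [-oo] when [A] is empty. *)
Definition diam (A : set 'rV[R]_n) : \bar R :=
  ereal_sup [set (enorm (x - y))%:E | x in A & y in A].

(* [diam A ^ s], with value 0 on the empty set for every [s], and with
   [0 ^ 0 = 1] on singletons. *)
Definition diam_pow (s : R) (A : set 'rV[R]_n) : \bar R :=
  if A == set0 then 0%E else poweR (diam A) s.

Definition hausdorff_premeasure (s delta : R) (Y : set 'rV[R]_n) : \bar R :=
  ereal_inf [set (\sum_(0 <= i <oo) diam_pow s (U i))%E | U in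
    [set U : nat -> set 'rV[R]_n |
      Y `<=` \bigcup_i U i /\ forall i, (diam (U i) <= delta%:E)%E]].

Definition hausdorff_measure (s : R) (Y : set 'rV[R]_n) : \bar R :=
  ereal_sup [set hausdorff_premeasure s delta Y | delta in [set d | 0 < d]].

Definition hausdorff_dim (Y : set 'rV[R]_n) : \bar R :=
  ereal_inf [set s%:E | s in [set s | 0 <= s /\ hausdorff_measure s Y = 0%E]].

Definition hausdorff_dim_measure
    (mu : {measure set (borelRn R n) -> \bar R}) : \bar R :=
  ereal_inf [set hausdorff_dim Y | Y in
    [set Y : set (borelRn R n) | measurable Y /\ mu (~` Y) = 0%E]].

End measures.

(* An element of Lip(X, R^k) is represented by any total function extending it:
   the definitions below only depend on the values on [X]. *)
Section Lip.
Context {R : realType} {n k : nat}.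
Implicit Types (X : set 'rV[R]_n) (h : 'rV[R]_n -> 'rV[R]_k).

Definition lip_bound X h (c : R) : Prop :=
  0 <= c /\
  forall x y, X x -> X y -> enorm (h x - h y) <= c * enorm (x - y).

Definition Lip X : set ('rV[R]_n -> 'rV[R]_k) :=
  [set h | exists c, lip_bound X h c].

Definition sup_norm X h : R := sup [set enorm (h x) | x in X].

Definition lip_const X h : R := inf [set c | lip_bound X h c].

(* The Lip norm when [X] is compact and [h] is Lipschitz on [X]; the real [sup]
   and [inf] are not meaningful otherwise. *)
Definition lip_norm X h : R := sup_norm X h + lip_const X h.

(* [U] is an open subset of Lip(X, R^k); the condition forces [U] to be
   invariant under changing a function outside [X]. *)
Definition open_Lip X (U : set ('rV[R]_n -> 'rV[R]_k)) : Prop :=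
  U `<=` Lip X /\
  forall f, U f -> exists2 e, 0 < e &
    forall g, Lip X g -> lip_norm X (g \- f) < e -> U g.

Definition full_rank (L : 'Hom('rV[R]_n, 'rV[R]_k)) : Prop :=
  \dim (limg L) = minn n k.

Definition injective_with_continuous_inverse (A : set 'rV[R]_n) h : Prop :=
  set_inj A h /\
  exists g : 'rV[R]_k -> 'rV[R]_n,
    (forall x, A x -> g (h x) = x) /\ {within h @` A, continuous g}.

End Lip.

(* Main.v *)
(* Let [X] be the unit ball of the maximum norm and [mu] a weighted sum of Dirac
   masses at all its rational points: a countable set of full measure has
   dimension [0], while every set of full measure contains all the atoms.
   A map that is Lipschitz-close on [X] to a linear surjection [L] differs from
   [L] by a map of small Lipschitz constant, so a fixed-point argument along the
   nonzero kernel of [L] gives [y <> 0] in [X] with [phi y = phi 0]. As [0] is an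
   atom and [y] a limit of atoms, an inverse of [phi] on the atoms cannot be
   continuous at [phi 0]. *)
Require Import Defs.
From HB Require Import structures.
From mathcomp Require Import all_boot all_order all_algebra.
From mathcomp Require Import ring lra.
From mathcomp Require Import all_classical all_reals all_analysis.
Import Order.TTheory GRing.Theory Num.Theory.
Import numFieldNormedType.Exports.

Set Implicit Arguments.
Unset Strict Implicit.
Unset Printing Implicit Defensive.

Local Open Scope classical_set_scope.
Local Open Scope ring_scope.

(** * Comparison of the Euclidean and maximum norms; fixed points in a compact ball *)

Section euclidean_and_max_norms.
Context {R : realType}.

Lemma norm_rV_leP n (x : 'rV[R]_n) (r : R) :
  0 <= r -> reflect (forall i, `|x ord0 i| <= r) (`|x| <= r).
Proof.
move=> r0; rewrite /Num.norm/= mx_normrE.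
apply: (iffP (bigmax_leP _ _ _ _)) => [[_ h] i|h]; first exact: (h (ord0, i)).
by split=> // -[i j] _ /=; rewrite (ord1 i); exact: h.
Qed.

Lemma norm_rV_coord n (x : 'rV[R]_n) i : `|x ord0 i| <= `|x|.
Proof. by move: (lexx `|x|) => /(norm_rV_leP x (normr_ge0 x)). Qed.

Lemma enorm_ge0 n (x : 'rV[R]_n) : 0 <= enorm x.
Proof. exact: sqrtr_ge0. Qed.

Lemma enorm0 n : enorm (0 : 'rV[R]_n) = 0.
Proof. by rewrite /enorm big1 ?sqrtr0// => i _; rewrite mxE expr0n. Qed.

Lemma norm_le_enorm n (x : 'rV[R]_n) : `|x| <= enorm x.
Proof.
apply/norm_rV_leP => [|i]; first exact: enorm_ge0.
rewrite -sqrtr_sqr ler_sqrt; last by apply: sumr_ge0 => j _; exact: sqr_ge0.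
by rewrite (bigD1 i)//= lerDl sumr_ge0// => j _; exact: sqr_ge0.
Qed.

Lemma enorm_le_sum n (x : 'rV[R]_n) : enorm x <= \sum_i `|x ord0 i|.
Proof.
have s0 : 0 <= \sum_i `|x ord0 i| by apply: sumr_ge0.
rewrite -[leRHS](ger0_norm s0) -sqrtr_sqr ler_sqrt ?sqr_ge0//.
(* Termwise, a square is at most one coordinate times the whole sum, since the sum contains that
   coordinate. *)
rewrite expr2 mulr_suml; apply: ler_sum => i _.
rewrite -real_normK ?num_real// expr2 ler_wpM2l//.
by rewrite (bigD1 i)//= lerDl sumr_ge0.
Qed.

Lemma enorm_mulmx_bound m n (B : 'M[R]_(m, n)) :
  exists2 K, 0 <= K & forall w : 'rV_m, enorm (w *m B) <= K * `|w|.
Proof.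
exists (\sum_j \sum_i `|B i j|) => [|w].
  by apply: sumr_ge0 => j _; apply: sumr_ge0.
apply: le_trans (enorm_le_sum _) _; rewrite mulr_suml.
apply: ler_sum => j _; rewrite mxE mulr_suml.
apply: le_trans (ler_norm_sum _ _ _) _; apply: ler_sum => i _.
by rewrite normrM mulrC ler_wpM2l// norm_rV_coord.
Qed.

Lemma enorm_le_norm n :
  exists2 C, 0 <= C & forall x : 'rV[R]_n, enorm x <= C * `|x|.
Proof.
have [C C0 h] := enorm_mulmx_bound (1%:M : 'M[R]_n).
by exists C => // x; rewrite -{1}[x]mulmx1.
Qed.

Lemma closed_norm_ball n (r : R) : closed [set w : 'rV[R]_n | `|w| <= r].
Proof.
rewrite (_ : [set w | _] = (fun w : 'rV[R]_n => `|w|) @^-1` [set t | t <= r])//.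
by apply: closed_comp => [x _|]; [exact: norm_continuous|exact: closed_le].
Qed.

Lemma compact_norm_ball n (r : R) : compact [set w : 'rV[R]_n | `|w| <= r].
Proof.
apply: bounded_closed_compact (@closed_norm_ball n r).
exists r; split; first exact: num_real.
by move=> M rM x /= /le_trans; apply; exact: ltW.
Qed.

(* [banach_fixed_point] does not apply: ['rV_n] has no [completeNormedModType]
   structure. Instead, a minimizer of [`|w - T w|] on the compact ball is a
   fixed point. *)
Lemma contraction_ball_fixed n (T : 'rV[R]_n -> 'rV[R]_n) (r q : R) :
  0 <= r -> 0 <= q -> q < 1 ->
  (forall w, `|w| <= r -> `|T w| <= r) ->
  (forall w w', `|w| <= r -> `|w'| <= r -> `|T w - T w'| <= q * `|w - w'|) ->
  exists2 w, `|w| <= r & T w = w.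
Proof.
move=> r0 q0 q1 Tr Tq.
pose X := [set w : 'rV[R]_n | `|w| <= r].
have Tc : {within X, continuous (fun w => `|w - T w|)}.
  apply/subspace_continuousP => w Xw.
  apply: (@cvg_comp _ _ _ (fun w => w - T w) Num.norm); last exact: norm_continuous.
  apply: cvgB; first exact: cvg_within.
  apply/cvgrPdist_le => e e0; near=> z.
  have Xz : X z by near: z; exact: withinT.
  apply: le_trans (Tq _ _ Xw Xz) _; apply: (@le_trans _ _ `|w - z|).
    by rewrite ler_piMl// ltW.
  near: z; apply: cvg_within.
  by apply/(@nbhs_normP R 'rV[R]_n w); exists e => // z /= /ltW.
have X0 : X 0 by rewrite /X/= normr0.
have [w0 /[!inE] Xw0 wmin] :=
  EVT_min_rV (ex_intro _ 0 X0) (@compact_norm_ball n r) Tc.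
exists w0 => //; apply/eqP; rewrite eq_sym -subr_eq0 -normr_le0 leNgt.
(* If [w0] were not fixed, [T w0] would be displaced by at most [q] times as much, against
   minimality. *)
apply/negP => w0T; have XT := Tr _ Xw0.
have := wmin (T w0); rewrite inE => /(_ XT); apply/negP; rewrite -ltNge.
by apply: le_lt_trans (Tq _ _ Xw0 XT) _; rewrite gtr_pMl.
Unshelve. all: by end_near. Qed.

End euclidean_and_max_norms.

(** * Atomic measures: finiteness, support, Hausdorff dimension *)

Section atomic_measures.
Context {R : realType} {n : nat}.

Lemma measurable_borelRn_open (V : set 'rV[R]_n) :
  open V -> measurable (V : set (borelRn R n)).
Proof. by move=> oV; apply: sub_sigma_algebra. Qed.

Lemma measurable_borelRn_set1 (x : 'rV[R]_n) :
  measurable ([set x] : set (borelRn R n)).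
Proof.
rewrite -(setCK [set x]); apply: measurableC.
apply: measurable_borelRn_open; apply: closed_openC.
exact/accessible_closed_set1/hausdorff_accessible/norm_hausdorff.
Qed.

Variable d : nat -> 'rV[R]_n.

(** Geometric weights bound the total mass by 1; the form is that of the summands in
    [epsilon_trick0]. *)
Definition atom_weight (i : nat) : R := 1 / (2 ^ i.+1)%:R.

Lemma atom_weight_gt0 i : 0 < atom_weight i.
Proof. by rewrite divr_gt0// ltr0n expn_gt0. Qed.

Definition atom (i : nat) : {measure set (borelRn R n) -> \bar R} :=
  mscale (NngNum (ltW (atom_weight_gt0 i))) (dirac (d i : borelRn R n)).

Definition atoms : set (borelRn R n) -> \bar R := mseries atom 0.

HB.instance Definition _ := Measure.on atoms.

Lemma atomE i A : atom i A = (atom_weight i * (d i \in A)%:R)%:E.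
Proof. by rewrite /atom/= /mscale/= diracE. Qed.

Lemma atoms_fin_num_fun : fin_num_fun atoms.
Proof.
apply: lty_fin_num_fun; apply: (@le_lt_trans _ _ 1%:E); last exact: ltry.
apply: le_trans (epsilon_trick0 xpredT ler01).
apply: lee_nneseries => [i _ _|i _]; first exact: measure_ge0.
by rewrite atomE in_setT mulr1.
Qed.

HB.instance Definition _ :=
  Measure_isFinite.Build _ _ _ atoms atoms_fin_num_fun.

Lemma atoms_gt0 (A : set (borelRn R n)) i : A (d i) -> (0 < atoms A)%E.
Proof.
move=> Adi; apply: (@lt_le_trans _ _ (atom_weight i)%:E).
  by rewrite lte_fin atom_weight_gt0.
apply: le_trans (nneseries_lim_ge i.+1 _) => [|j _ _]; last exact: measure_ge0.
rewrite big_nat_recr//= atomE mem_set// mulr1 leeDr// sume_ge0//.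
Qed.

Lemma atoms_eq0 (A : set (borelRn R n)) : (forall i, ~ A (d i)) -> atoms A = 0%E.
Proof.
move=> Ad; apply: eseries0 => i _ _.
by rewrite atomE memNset ?mulr0//; exact: Ad.
Qed.

(** A missed atom would lie in the Borel null set covering the complement, which would then have
    positive mass. *)
Lemma atoms_full_measure (A : set 'rV[R]_n) i : full_measure atoms A -> A (d i).
Proof.
move=> [B [mB B0 AB]]; apply: contrapT => /AB /atoms_gt0.
by rewrite B0 ltxx.
Qed.

Lemma support_atoms : measure_support atoms = closure (range d).
Proof.
apply/seteqP; split => x /=.
  move=> xs B; rewrite nbhsE => -[V [oV Vx] VB].
  apply: contrapT => dB.
  have := xs V oV Vx; rewrite /= atoms_eq0 ?ltxx// => i Vdi.
  by apply: dB; exists (d i); split; [exists i|exact: VB].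
move=> xd V oV Vx.
have [y [[i _ <-] Vdi]] := xd V (open_nbhs_nbhs (conj oV Vx)).
exact: atoms_gt0 Vdi.
Qed.

Lemma diam_set1 (x : 'rV[R]_n) : diam [set x] = 0%E.
Proof.
rewrite /diam (_ : [set _ | _ in _ & _ in _] = [set 0%E]) ?ereal_sup1//.
apply/seteqP; split => [_ [a -> [b -> <-]]|_ ->] /=; first by rewrite subrr enorm0.
by exists x => //; exists x => //; rewrite subrr enorm0.
Qed.

Lemma diam_pow_ge0 (s : R) (A : set 'rV[R]_n) : (0 <= diam_pow s A)%E.
Proof. by rewrite /diam_pow; case: ifP => // _; exact: poweR_ge0. Qed.

Lemma hausdorff_premeasure_ge0 (s delta : R) (Y : set 'rV[R]_n) :
  (0 <= hausdorff_premeasure s delta Y)%E.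
Proof.
apply/ereal_infP => _ [U _ <-]; apply: nneseries_ge0 => i _ _.
exact: diam_pow_ge0.
Qed.

Lemma hausdorff_dim_ge0 (Y : set 'rV[R]_n) : (0 <= hausdorff_dim Y)%E.
Proof. by apply/ereal_infP => _ [s [s0 _] <-]; rewrite lee_fin. Qed.

Lemma hausdorff_measure_range (s : R) : 0 < s -> hausdorff_measure s (range d) = 0%E.
Proof.
move=> s0; have pm0 delta : 0 < delta -> hausdorff_premeasure s delta (range d) = 0%E.
  move=> delta0; apply/eqP; rewrite eq_le hausdorff_premeasure_ge0 andbT.
  (* The singletons form a cover of diameter 0, admissible for every [delta]; their [s]-th powers
     vanish because [s] is positive. *)
  apply: ereal_inf_lbound; exists (fun i => [set d i]).
    split=> [_ [i _ <-]|i]; first by exists i.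
    by rewrite diam_set1 lee_fin ltW.
  apply: eseries0 => i _ _; rewrite /diam_pow diam_set1 poweR0r ?if_same//.
  by rewrite gt_eqF.
rewrite /hausdorff_measure (_ : [set _ | _ in _] = [set 0%E]) ?ereal_sup1//.
apply/seteqP; split => [_ [delta /= delta0 <-]|_ ->]; first exact: pm0.
by exists 1 => //=; rewrite pm0.
Qed.

(** Every positive exponent is admissible but 0 is not, as singletons then count 1; hence the
    passage to the limit [e] to 0. *)
Lemma hausdorff_dim_range : hausdorff_dim (range d) = 0%E.
Proof.
apply/eqP; rewrite eq_le hausdorff_dim_ge0 andbT.
apply/lee_addgt0Pr => e e0; rewrite add0e.
apply: ereal_inf_lbound; exists e => //; split; first exact: ltW.
exact: hausdorff_measure_range.
Qed.

Lemma hausdorff_dim_atoms : hausdorff_dim_measure atoms = 0%E.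
Proof.
apply/eqP; rewrite eq_le; apply/andP; split; last first.
  by apply/ereal_infP => _ [Y _ <-]; exact: hausdorff_dim_ge0.
apply: ereal_inf_lbound; exists (range d); last exact: hausdorff_dim_range.
split; last by apply: atoms_eq0 => i; apply; exists i.
apply: countable_measurable; first exact: measurable_borelRn_set1.
exact: card_image_le.
Qed.

End atomic_measures.

(** * Density of the rational points in the unit ball *)

Section rational_points.
Context {R : realType} {n : nat}.

(* Codes that do not decode to a rational point of the ball give [0]. *)
Definition rational_ball_point (i : nat) : 'rV[R]_n :=
  let x := map_mx ratr (odflt 0 (unpickle i : option 'rV[rat]_n)) in
  if `|x| <= 1 then x else 0.

Lemma norm_rational_ball_point i : `|rational_ball_point i| <= 1.
Proof. by rewrite /rational_ball_point; case: ifPn => // _; rewrite normr0. Qed.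

Lemma rational_ball_point_onto (q : 'rV[rat]_n) :
  `|map_mx ratr q : 'rV[R]_n| <= 1 ->
  exists i, rational_ball_point i = map_mx ratr q.
Proof. by move=> q1; exists (pickle q); rewrite /rational_ball_point pickleK/= q1. Qed.

Lemma rational_ball_point0 : exists i, rational_ball_point i = 0.
Proof.
have := @rational_ball_point_onto 0; rewrite map_mx0 normr0 ler01.
by move=> /(_ isT).
Qed.

Lemma rational_ball_point_dense (x : 'rV[R]_n) (e : R) : `|x| <= 1 -> 0 < e ->
  exists i, `|x - rational_ball_point i| < e.
Proof.
move=> x1 e0; pose e' := Num.min (e / 2) 1.
have e'0 : 0 < e' by rewrite lt_min ltr01 divr_gt0.
have e'e : e' < e by rewrite gt_min ltr_pdivrMr// mulrDr mulr1 ltrDl e0.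
have xi i : exists q : rat, `|ratr q : R| <= 1 /\ `|x ord0 i - ratr q| <= e'.
  have /ler_normlP[xn xp] := le_trans (norm_rV_coord x i) x1.
  (* Cutting the interval at -1 and 1 keeps the rational point inside the ball, even when [x] is on
     the boundary. *)
  have [|q] := @rat_in_itvoo R
    (Num.max (x ord0 i - e') (-1)) (Num.min (x ord0 i + e') 1).
    rewrite gt_max !lt_min; lra.
  rewrite in_itv/= gt_max lt_min => /andP[/andP[q1 q2] /andP[q3 q4]].
  by exists q; split; apply/ler_normlP; split; lra.
have [q hq] := choice xi.
have [|i qi] := @rational_ball_point_onto (\row_i q i).
  by apply/norm_rV_leP => // i; rewrite !mxE; have [] := hq i.
exists i; rewrite qi; apply: le_lt_trans e'e.
apply/norm_rV_leP => [|j]; first exact: ltW.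
by rewrite !mxE; have [] := hq j.
Qed.

Lemma closure_rational_ball_point :
  closure (range rational_ball_point) = [set x | `|x| <= 1].
Proof.
apply/seteqP; split.
  rewrite [X in _ `<=` X]((closure_id _).1 (@closed_norm_ball R n 1)).
  by apply: closure_subset => _ [i _ <-]; exact: norm_rational_ball_point.
move=> x /= x1 B /(@nbhs_normP R 'rV[R]_n x)[e /= e0 eB].
have [i xi] := rational_ball_point_dense x1 e0.
by exists (rational_ball_point i); split; [exists i|exact: eB].
Qed.

End rational_points.

(** * Lipschitz perturbations of linear surjections *)

Section perturbed_surjections.
Context {R : realType} {N k : nat}.
Implicit Types (X : set 'rV[R]_N) (phi : 'rV[R]_N -> 'rV[R]_k).

(* [phi] differs from the surjection [x |-> x *m A] by a map whose Lipschitz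
   constant is smaller than the inverse of the norm of a section [B]. *)
Definition perturbed_surjection X phi : Prop :=
  exists (A : 'M[R]_(N, k)) (B : 'M[R]_(k, N)) (c K : R),
    [/\ B *m A = 1%:M, 0 <= c, 0 <= K & c * K < 1] /\
    (forall w, enorm (w *m B) <= K * `|w|) /\
    (forall x y, X x -> X y ->
      `|(phi x - x *m A) - (phi y - y *m A)| <= c * enorm (x - y)).

Lemma exists_ker_vector (A : 'M[R]_(N, k)) : (k < N)%N ->
  exists2 v : 'rV[R]_N, v != 0 & v *m A = 0.
Proof.
move=> kN; exists (nz_row (kermx A)); last exact/sub_kermxP/nz_row_sub.
rewrite nz_row_eq0 -mxrank_eq0 mxrank_ker -lt0n subn_gt0.
exact: leq_ltn_trans (rank_leq_col A) kN.
Qed.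

(* Moving by a small kernel vector [v] changes [phi] little, and a correction
   [w *m B], with [w] obtained as a fixed point, restores the value [phi 0]. *)
Lemma perturbed_surjection_fiber phi : (k < N)%N ->
  perturbed_surjection [set x | `|x| <= 1] phi ->
  exists y, [/\ `|y| <= 1, y != 0 & phi y = phi 0].
Proof.
move=> kN [A [B [c [K [[BA c0 K0 cK] [BK psic]]]]]].
have [v0 v0_neq0 v0A] := exists_ker_vector A kN.
have [C C0 normC] := @enorm_le_norm R N.
(* With [K * r] and [s] both at most 1/2, the points [v + w *m B] stay in the unit ball. *)
pose r := (2 * (K + 1))^-1.
have r0 : 0 < r by rewrite invr_gt0; lra.
have Kr : K * r <= 1 / 2.
  by rewrite /r invfM mulrCA mulrA ler_pdivrMr; lra.
have cC1 : 0 < c * C + 1 by have := mulr_ge0 c0 C0; lra.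
(* The second bound gives [T 0] norm at most [(1 - c * K) * r], which leaves room for the
   contraction term [c * K * r] in the ball of radius [r]. *)
pose s := Num.min (1 / 2) ((1 - c * K) * r / (c * C + 1)).
have s0 : 0 < s.
  by rewrite lt_min divr_gt0//= divr_gt0// mulr_gt0// subr_gt0.
have s_half : s <= 1 / 2 by rewrite ge_min lexx.
have cCs : c * (C * s) <= (1 - c * K) * r.
  apply: (@le_trans _ _ ((c * C + 1) * s)); first by rewrite mulrA; lra.
  by rewrite mulrC -ler_pdivlMr// ge_min lexx orbT.
clearbody s r.
pose v := (s / `|v0|) *: v0.
have vA : v *m A = 0 by rewrite -scalemxAl v0A scaler0.
have nv : `|v| = s.
  rewrite normrZ ger0_norm ?divr_ge0 ?(ltW s0)// divfK//.
  by rewrite normr_eq0.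
clearbody v.
pose psi x := phi x - x *m A.
(* Since [(v + w *m B) *m A = w], the value of [phi] at [v + w *m B] is [w + psi (v + w *m B)]; it
   equals [phi 0] exactly when [T w = w]. *)
pose T w := psi 0 - psi (v + w *m B).
have vwB1 w : `|w| <= r -> `|v + w *m B| <= 1.
  move=> wr; apply: le_trans (ler_normD _ _) _; rewrite nv.
  have h1 := le_trans (norm_le_enorm (w *m B)) (BK w).
  have h2 := ler_wpM2l K0 wr; lra.
have Tq w w' : `|w| <= r -> `|w'| <= r -> `|T w - T w'| <= c * K * `|w - w'|.
  move=> wr wr'.
  have -> : T w - T w' = psi (v + w' *m B) - psi (v + w *m B).
    rewrite /T; move: (psi 0) (psi (v + w *m B)) (psi (v + w' *m B)) => a b d.
    by rewrite opprB addrC subrKA.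
  rewrite distrC.
  apply: le_trans (psic _ _ (vwB1 _ wr) (vwB1 _ wr')) _.
  rewrite -mulrA ler_wpM2l//; apply: le_trans (BK _).
  by rewrite mulmxBl opprD addrACA subrr add0r.
have Tr w : `|w| <= r -> `|T w| <= r.
  move=> wr.
  have T0 : `|T 0| <= (1 - c * K) * r.
    rewrite /T mul0mx addr0; apply: le_trans cCs.
    apply: le_trans (psic _ _ _ _) _; rewrite /= ?normr0 ?nv//; first lra.
    rewrite ler_wpM2l//; apply: le_trans (normC _) _.
    by rewrite sub0r normrN nv.
  have Tw0 := Tq _ _ wr (_ : `|0| <= r).
  have {}Tw0 : `|T w - T 0| <= c * K * r.
    apply: le_trans (Tw0 _) _; first by rewrite normr0 ltW.
    by rewrite subr0 ler_wpM2l// mulr_ge0.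
  have := ler_normD (T w - T 0) (T 0); rewrite subrK; lra.
have [w wr Tw] := contraction_ball_fixed (ltW r0) (mulr_ge0 c0 K0) cK Tr Tq.
have yA : (v + w *m B) *m A = w by rewrite mulmxDl vA add0r -mulmxA BA mulmx1.
exists (v + w *m B); split; first exact: vwB1.
  (* If the point were 0, applying [A] would give [w = 0], hence [v = 0], although [v] has norm
     [s]. *)
  apply/eqP => y0; move: yA; rewrite y0 mul0mx => w0.
  move: y0; rewrite -w0 mul0mx addr0 => v_eq0.
  by move: s0; rewrite -nv v_eq0 normr0 ltxx.
move: Tw; rewrite /T /psi yA mul0mx subr0 => /eqP.
by rewrite subr_eq [w + _]addrC subrK => /eqP.
Qed.

Lemma Lip_sub X phi phi' : Lip X phi -> Lip X phi' -> Lip X (phi \- phi').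
Proof.
move=> [c [c0 hc]] [c' [c'0 hc']]; have [C C0 normC] := @enorm_le_norm R k.
(* The triangle inequality is applied in the maximum norm; the factor [C] pays for the return to the
   Euclidean norm. *)
exists (C * (c + c')); split; first by rewrite mulr_ge0// addr_ge0.
move=> x y Xx Xy; apply: le_trans (normC _) _.
rewrite -mulrA ler_wpM2l// mulrDl.
have -> : (phi \- phi') x - (phi \- phi') y =
    (phi x - phi y) - (phi' x - phi' y).
  by apply/rowP => i; rewrite !mxE; ring.
apply: le_trans (ler_normB _ _) (lerD _ _).
  exact: le_trans (norm_le_enorm _) (hc _ _ Xx Xy).
exact: le_trans (norm_le_enorm _) (hc' _ _ Xx Xy).
Qed.

Lemma sup_norm_ge0 X phi : 0 <= sup_norm X phi.
Proof.
rewrite /sup_norm.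
(* For an empty or unbounded set [sup] takes its default value 0. *)
have [hs|/sup_out->//] := pselect (has_sup [set enorm (phi x) | x in X]).
have [[_ [x Xx _]] _] := hs.
apply: le_trans (enorm_ge0 (phi x)) _.
by apply: sup_upper_bound => //; exists x.
Qed.

(** Yields an actual Lipschitz bound below [e], with no need for the infimum to be attained. *)
Lemma lip_norm_lt X phi e : Lip X phi -> lip_norm X phi < e ->
  exists2 c, lip_bound X phi c & c < e.
Proof.
move=> phiL phie; apply: inf_lt; first exact: phiL.
by apply: le_lt_trans phie; rewrite lerDr sup_norm_ge0.
Qed.

(** The same [A], [B] and [K] serve for a nearby [g]; only [c] grows, by a Lipschitz bound of
    [g - f], and the strict inequality [c * K < 1] leaves room for this. *)
Lemma open_Lip_perturbed_surjection X :
  open_Lip X (Lip X `&` perturbed_surjection X).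
Proof.
split=> [phi []//|f [fL [A [B [c [K [[BA c0 K0 cK] [BK fc]]]]]]]].
(* Then [c' < e] gives [(c + c') * K < 1]; the denominator [K + 1] is positive even if [K] is 0. *)
pose e := (1 - c * K) / (K + 1).
have K1 : 0 < K + 1 by lra.
exists e => [|g gL gfe]; first by rewrite divr_gt0// subr_gt0.
split=> //; have [c' [c'0 gfc] c'e] := lip_norm_lt (Lip_sub gL fL) gfe.
exists A, B, (c + c'), K; split; [split|split] => //; first exact: addr_ge0.
  have : c' * (K + 1) < 1 - c * K by rewrite -ltr_pdivlMr.
  have := mulr_ge0 c'0 K0; lra.
move=> x y Xx Xy; rewrite mulrDl.
have h1 := fc _ _ Xx Xy.
have h2 := le_trans (norm_le_enorm _) (gfc _ _ Xx Xy).
apply: le_trans (lerD h1 h2); apply: le_trans (ler_normD _ _).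
rewrite le_eqVlt; apply/orP; left; apply/eqP; congr `|_| => /=.
by apply/rowP => i; rewrite !mxE; ring.
Qed.

(** For [k <= N] full rank means surjective, so the pseudo-inverse [L^-1] gives the section [B]; the
    perturbation is zero and [c = 0] works. *)
Lemma full_rank_perturbed_surjection X (L : 'Hom('rV[R]_N, 'rV[R]_k)) :
  (k <= N)%N -> full_rank L -> (Lip X `&` perturbed_surjection X) L.
Proof.
move=> kN; rewrite /full_rank (minn_idPr kN) => rk.
have Lfull : limg L = fullv.
  by apply/eqP; rewrite eqEdim subvf dimvf rk /dim/= mul1n.
pose A := lin1_mx L; pose B := lin1_mx (L^-1)%VF.
have LA x : L x = x *m A by rewrite mul_rV_lin1.
have [C C0 hA] := enorm_mulmx_bound A.
have [K K0 hB] := enorm_mulmx_bound B.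
split.
  exists C; split=> // x y _ _; rewrite !LA -mulmxBl.
  by apply: le_trans (hA _) _; rewrite ler_wpM2l// norm_le_enorm.
exists A, B, 0, K; split; [split => //|split => // x y _ _].
- apply/row_matrixP => i; rewrite rowE mulmxA !mul_rV_lin1.
  by rewrite /= limg_lfunVK ?Lfull ?memvf// row1.
- by rewrite mul0r ltr01.
- by rewrite !LA !subrr normr0 mul0r.
Qed.

End perturbed_surjections.

(** * Discontinuity of the inverse, and the final assembly *)

Lemma within_continuous_noninjective (R : realType) (N k : nat)
    (A X : set 'rV[R]_N) (phi : 'rV[R]_N -> 'rV[R]_k) (x y : 'rV[R]_N) :
  Lip X phi -> A `<=` X -> A x -> X y -> closure A y -> y != x ->
  phi y = phi x -> ~ injective_with_continuous_inverse A phi.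
Proof.
move=> [c [c0 hc]] AX Ax Xy Ay yx phiyx [_ [g [gphi gc]]].
have [C C0 normC] := @enorm_le_norm R N.
have yx0 : 0 < `|y - x| / 2 by rewrite divr_gt0// normr_gt0 subr_eq0.
have := (subspace_continuousP _ _).1 gc (phi x) (ex_intro2 _ _ x Ax erefl).
move=> /cvgrPdist_lt /(_ _ yx0); rewrite near_withinE.
move=> /(@nbhs_normP R 'rV[R]_k (phi x))[e /= e0 he].
have cC1 : 0 < c * C + 1 by have := mulr_ge0 c0 C0; lra.
(* A point [a] of [A] this close to [y] has [phi a] within [e] of [phi y = phi x], so continuity of
   [g] puts [a] within half of [|y - x|] of [x]; but [a] is also that close to [y], contradicting
   the triangle inequality. *)
pose delta := Num.min (`|y - x| / 2) (e / (c * C + 1)).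
have delta0 : 0 < delta by rewrite lt_min yx0 divr_gt0.
have [a [Aa ya]] : A `&` [set a | `|y - a| < delta] !=set0.
  by apply: Ay; apply/(@nbhs_normP R 'rV[R]_N y); exists delta.
move: ya; rewrite /= lt_min => /andP[ya1]; rewrite ltr_pdivlMr// => ya2.
have phia : `|phi x - phi a| < e.
  rewrite -phiyx; apply: le_lt_trans ya2.
  apply: le_trans (norm_le_enorm _) _; apply: le_trans (hc _ _ Xy (AX _ Aa)) _.
  apply: le_trans (ler_wpM2l c0 (normC _)) _.
  by rewrite mulrA mulrC mulrDr mulr1 lerDl.
have := he _ phia (ex_intro2 _ _ a Aa erefl); rewrite /from_subspace !gphi// => xa.
have := ler_distD a y x; rewrite (distrC a x); lra.
Qed.

Theorem proposition6p1 (R : realType) (N k : nat)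
    (k_ge1 : (1 <= k)%N) (k_ltN : (k < N)%N) :
  exists (mu : {finite_measure set (borelRn R N) -> \bar R})
         (X : set 'rV[R]_N) (U : set ('rV[R]_N -> 'rV[R]_k)),
    X = measure_support mu /\
    compact X /\
    open_Lip X U /\
    (forall L : 'Hom('rV[R]_N, 'rV[R]_k), full_rank L -> U L) /\
    hausdorff_dim_measure mu = 0%E /\
    forall phi : 'rV[R]_N -> 'rV[R]_k, U phi ->
      ~ exists Xphi : set 'rV[R]_N,
          Xphi `<=` X /\ full_measure mu Xphi /\
          injective_with_continuous_inverse Xphi phi.
Proof.
pose X := [set x : 'rV[R]_N | `|x| <= 1].
pose d := @rational_ball_point R N.
exists (atoms d), X, (Lip X `&` perturbed_surjection X).
split; first by rewrite /= support_atoms closure_rational_ball_point.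
split; first exact: compact_norm_ball.
split; first exact: open_Lip_perturbed_surjection.
split.
  by move=> L; apply: full_rank_perturbed_surjection; exact: ltnW.
split; first exact: hausdorff_dim_atoms.
move=> phi [phiL phiX] [A [AX [muA]]].
have Ad i : A (d i) := atoms_full_measure i muA.
have [y [Xy y0 phiy]] := perturbed_surjection_fiber k_ltN phiX.
apply: (within_continuous_noninjective phiL AX _ Xy _ y0 phiy).
  by have [i <-] := @rational_ball_point0 R N; exact: Ad.
(* [A] contains all atoms, so its closure contains the whole ball, in particular [y]. *)
suff : closure (range d) y by apply: closure_subset => _ [i _ <-]; exact: Ad.
by rewrite closure_rational_ball_point.
Qed.
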